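(* Let $P_1$ be the Cantor distribution satisfying $P_1=\frac12P_1\circ S_1^{-1}+\frac12P_1\circ S_2^{-1}$ with $S_1(x)=\frac13x$ and $S_2(x)=\frac13x+\frac13$, let $P_2$ be the discrete distribution with mass $\frac13$ at each point of $D=\{\frac23,\frac56,1\}$, and let $P=\frac12P_1+\frac12P_2$. Let $\alpha$ be an optimal set of two-means for $P$. Then $\alpha=\{\frac14,\frac56\}$, and the quantization error is $V_2(P)=\frac{43}{1728}$.
   Context: $P_1$ is the unique Borel probability measure on $\mathbb R$ satisfying the stated self-similarity relation; its support is the Cantor set in $[0,\frac12]$ generated by $S_1,S_2$. For a Borel probability measure $Q$ on $\mathbb R$ with finite second moment and a finite nonempty set $\alpha\subset\mathbb R$, put $V(Q;\alpha)=\int\min_{a\in\alpha}(x-a)^2\,dQ(x)$ and $V_n(Q)=\inf\{V(Q;\alpha):\alpha\subset\mathbb R,\ 1\le\mathrm{card}(\alpha)\le n\}$ (the $n$th quantization error). A set $\alpha$ with $1\le\mathrm{card}(\alpha)\le n$ is an optimal set of $n$-means for $Q$ if $V(Q;\alpha)=V_n(Q)$; ''two-means'' is the case $n=2$. *)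

(* Defs.v *)
From HB Require Import structures.
From mathcomp Require Import all_boot all_order all_algebra finmap.
From mathcomp Require Import all_classical all_reals all_analysis.

Set Implicit Arguments.
Unset Strict Implicit.
Unset Printing Implicit Defensive.

Import Order.TTheory GRing.Theory Num.Theory.
Import numFieldNormedType.Exports.

Local Open Scope classical_set_scope.
Local Open Scope ring_scope.

(* The type [measurableTypeR R] is R with its Borel sigma-algebra. *)
Notation borel_probability R := (probability (measurableTypeR R) R).

Section quantization.
Context {R : realType}.
Implicit Types (Q : borel_probability R) (alpha : {fset R}) (n : nat).

(* V(Q; alpha).  The default value +oo of the minimum is returned only for
   the empty set, which every use below excludes. *)
Definition distortion Q alpha : \bar R :=
  (\int[Q]_x \big[mine/+oo]_(a <- alpha) ((x - a) ^+ 2)%:E)%E.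

Definition codebooks n : set {fset R} :=
  [set alpha | (1 <= #|` alpha| <= n)%N].

Definition quantization_error n Q : \bar R :=
  ereal_inf [set distortion Q alpha | alpha in codebooks n].

Definition optimal_means n Q alpha : Prop :=
  codebooks n alpha /\ distortion Q alpha = quantization_error n Q.

End quantization.

Section cantor.
Context {R : realType}.

Definition S1 : measurableTypeR R -> measurableTypeR R := fun x => 3^-1 * x.

Definition S2 : measurableTypeR R -> measurableTypeR R :=
  fun x => 3^-1 * x + 3^-1.

(* These two maps are similarities with fixed points 0 and 1/2, so the
   distribution lives on [0, 1/2] and not on the usual Cantor set. *)
Definition is_cantor_distribution (P1 : borel_probability R) : Prop :=
  forall A : set (measurableTypeR R), measurable A ->
    P1 A = ((2^-1)%:E * pushforward P1 S1 A
            + (2^-1)%:E * pushforward P1 S2 A)%E.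

End cantor.

Section three_point_uniform.
Context {d : measure_display} {T : measurableType d} {R : realType}.
Variables a b c : T.

Definition three_point_uniform : set T -> \bar R :=
  mscale 3^-1%:nng (msum (fun i => dirac (nth a [:: a; b; c] i)) 3).

HB.instance Definition _ := Measure.on three_point_uniform.

Lemma three_point_uniformE A : three_point_uniform A =
  ((3^-1)%:E * (\d_a A + \d_b A + \d_c A))%E.
Proof.
by rewrite /three_point_uniform /mscale /= /msum !big_ord_recl big_ord0 /= adde0 addeA.
Qed.

Let three_point_uniform_setT : three_point_uniform setT = 1%E.
Proof.
rewrite three_point_uniformE !diracT -!EFinD -EFinM; congr EFin.
by rewrite -addrA (_ : 1 + (1 + 1) = 3%:R) // mulVf ?pnatr_eq0.
Qed.

HB.instance Definition _ :=
  Measure_isProbability.Build _ _ _ three_point_uniform three_point_uniform_setT.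

End three_point_uniform.

Definition discrete_distribution_D (R : realType) : borel_probability R :=
  three_point_uniform (2 / 3 : measurableTypeR R) (5 / 6 : measurableTypeR R)
    (1 : measurableTypeR R).

Section half_mixture.
Context {d : measure_display} {T : measurableType d} {R : realType}.
Variables P1 P2 : probability T R.

Definition half_mixture : set T -> \bar R :=
  measure_add (mscale 2^-1%:nng P1) (mscale 2^-1%:nng P2).

HB.instance Definition _ := Measure.on half_mixture.

Lemma half_mixtureE A :
  half_mixture A = ((2^-1)%:E * P1 A + (2^-1)%:E * P2 A)%E.
Proof. by rewrite /half_mixture measure_addE. Qed.

Let half_mixture_setT : half_mixture setT = 1%E.
Proof.
rewrite half_mixtureE !probability_setT !mule1 -EFinD.
by congr EFin; rewrite [RHS](splitr 1) div1r.
Qed.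

HB.instance Definition _ :=
  Measure_isProbability.Build _ _ _ half_mixture half_mixture_setT.

End half_mixture.

(* Main.v *)
(* For a <= b let m = (a + b) / 2 be the boundary between the two cells.  If m
   lies in [1/2, 2/3] then a serves exactly the Cantor part and b exactly D, so
   the error is 43/1728 + ((a - 1/4)^2 + (b - 5/6)^2) / 2.  Any other m is
   strictly worse:
   - if m > 2/3, then a serves the Cantor part and the point 2/3;
   - if m <= 1/3, then b serves the right half of the Cantor part and D;
   - if 1/3 < m < 1/2, then a serves the left half of the Cantor part, b serves
     D, and the integrand on the right half is bounded below by (x - a)^2 minus
     an affine function.
   In each case the integrand on either half of the Cantor set dominates a
   quadratic polynomial, so only the mean 1/4 and the second moment 3/32 of the
   Cantor distribution enter. *)

Require Import Defs.
From HB Require Import structures.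
From mathcomp Require Import all_boot all_order all_algebra finmap.
From mathcomp Require Import all_classical all_reals all_analysis.
From mathcomp Require Import measurable_realfun.
From mathcomp Require Import ring lra.

Import Order.TTheory GRing.Theory Num.Theory.
Import numFieldNormedType.Exports.

Local Open Scope classical_set_scope.
Local Open Scope ring_scope.

(** * Support and self-similarity of the Cantor distribution *)

Lemma measurable_S1 (R : realType) : measurable_fun setT (@S1 R).
Proof. exact: measurable_funM. Qed.

Lemma measurable_S2 (R : realType) : measurable_fun setT (@S2 R).
Proof. by apply: measurable_funD => //; exact: measurable_funM. Qed.

HB.instance Definition _ (R : realType) :=
  isMeasurableFun.Build _ _ _ _ (@S1 R) (@measurable_S1 R).

HB.instance Definition _ (R : realType) :=
  isMeasurableFun.Build _ _ _ _ (@S2 R) (@measurable_S2 R).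

Section cantor_distribution.
Context {R : realType} (P1 : borel_probability R).
Hypothesis hP1 : is_cantor_distribution P1.

Let K : set (measurableTypeR R) := `[0, 2^-1].

Let tail (e : R) : set (measurableTypeR R) := ~` `[- e, 2^-1 + e].

Let measurable_tail e : measurable (tail e).
Proof. by apply: measurableC; exact: measurable_itv. Qed.

(* Both maps pull the complement of the e-neighbourhood of [0, 1/2] back into
   the complement of the 3e-neighbourhood. *)
Let tail_triple e : 0 <= e -> (P1 (tail e) <= P1 (tail (3 * e)))%E.
Proof.
move=> e0.
have le_tail (S : measurableTypeR R -> measurableTypeR R) :
    measurable_fun setT S ->
    (forall x, - (3 * e) <= x <= 2^-1 + 3 * e -> - e <= S x <= 2^-1 + e) ->
    (pushforward P1 S (tail e) <= P1 (tail (3 * e)))%E.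
  move=> mS Se; rewrite /pushforward; apply: le_measure; rewrite ?inE//.
    by rewrite -[X in measurable X]setTI; exact: mS.
  by apply: subsetC => x; rewrite /= !in_itv /=; exact: Se.
have H1 : (pushforward P1 S1 (tail e) <= P1 (tail (3 * e)))%E.
  apply: le_tail; first exact: measurable_S1.
  by move=> x /andP[? ?]; rewrite /S1; apply/andP; split; lra.
have H2 : (pushforward P1 S2 (tail e) <= P1 (tail (3 * e)))%E.
  apply: le_tail; first exact: measurable_S2.
  by move=> x /andP[? ?]; rewrite /S2; apply/andP; split; lra.
rewrite hP1//.
have -> : P1 (tail (3 * e)) = ((2^-1)%:E * P1 (tail (3 * e))
    + (2^-1)%:E * P1 (tail (3 * e)))%E.
  rewrite -ge0_muleDl ?lee_fin// -EFinD.
  by rewrite (_ : 2^-1 + 2^-1 = 1 :> R) ?mul1e//; lra.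
by rewrite leeD// lee_pmul2l// ?lte_fin// invr_gt0.
Qed.

(** Iterating [tail_triple] bounds the mass by that of [tail (3 ^+ k * e)] for every k. These sets
    decrease to the empty set, so continuity from above sends the bound to 0. *)
Let tail0 e : 0 < e -> P1 (tail e) = 0%E.
Proof.
move=> e0.
pose F k := tail (3 ^+ k * e).
have F0 : \bigcap_k F k = set0.
  apply/seteqP; split => // x /= Fx.
  have xn := archi_boundP (normr_ge0 (x / e)); set n := Num.bound _ in xn.
  apply: (Fx n I) => /=; rewrite in_itv /=.
  have : `|x| <= 3 ^+ n * e.
    rewrite -ler_pdivrMr// -[e in leLHS]gtr0_norm// -normf_div.
    rewrite (le_trans (ltW xn))//.
    by rewrite -natrX ler_nat ltnW// ltn_expl.
  by rewrite ler_norml => /andP[xl xr]; apply/andP; split; lra.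
have cF : P1 (F k) @[k --> \oo] --> 0%E.
  rewrite -(measure0 P1) -F0; apply: nonincreasing_cvg_mu => //.
  - by rewrite -ge0_fin_numE// fin_num_measure//; exact: measurable_tail.
  - by move=> k; exact: measurable_tail.
  - by rewrite F0.
  - apply/nonincreasing_seqP => k; apply/subsetPset; rewrite /F exprS -mulrA.
    have : 0 < 3 ^+ k * e by rewrite mulr_gt0// exprn_gt0.
    move: (3 ^+ k * e) => r r0; apply: subsetC => x.
    by rewrite /= !in_itv /= => /andP[? ?]; apply/andP; split; lra.
apply/eqP; rewrite eq_le measure_ge0 andbT.
apply: (cvge_ge _ cF); apply: nearW => k; rewrite /F.
elim: k => [|k IH]; first by rewrite expr0 mul1r.
by rewrite exprS -mulrA (le_trans IH)// tail_triple// mulr_ge0 ?exprn_ge0// ltW.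
Qed.

Lemma cantor_support : P1 (~` `[0, 2^-1]) = 0%E.
Proof.
have -> : ~` `[0, 2^-1] = \bigcup_n tail n.+1%:R^-1.
  apply/seteqP; split => [x xK|x [n _]]; last first.
    have : 0 < n.+1%:R^-1 :> R by rewrite invr_gt0.
    move: n.+1%:R^-1 => e e0 xe xK; apply: xe.
    by move: xK; rewrite /K /= !in_itv /= => /andP[? ?]; apply/andP; split; lra.
  (* Half the distance from x to [0, 1/2] serves as e. *)
  have : exists2 e : R, 0 < e & tail e x.
    move/negP: xK; rewrite /K /= in_itv /= negb_and -!ltNge => /orP[x0|x2].
      exists (- x / 2); first by rewrite divr_gt0// oppr_gt0.
      by rewrite /tail /= in_itv /= => /andP[? ?]; lra.
    exists ((x - 2^-1) / 2); first by rewrite divr_gt0// subr_gt0.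
    by rewrite /tail /= in_itv /= => /andP[? ?]; lra.
  move=> [e e0 xe]; have en := archi_boundP (ltW (_ : 0 < e^-1)).
  exists (Num.bound e^-1) => // xn; apply: xe; move: xn.
  have : (Num.bound e^-1).+1%:R^-1 <= e.
    rewrite -[leRHS]invrK lef_pV2 ?posrE ?invr_gt0//.
    by rewrite (le_trans (ltW (en _))) ?invr_gt0// ler_nat.
  move: (Num.bound e^-1).+1%:R^-1 => r.
  by rewrite /= !in_itv /= => ne /andP[? ?]; apply/andP; split; lra.
by apply: measure_negligible; [exact: bigcupT_measurable|];
  apply: negligible_bigcup => n; exists (tail n.+1%:R^-1);
  split; [exact: measurable_tail|by apply: tail0; rewrite invr_gt0|by []].
Qed.

(** The hypothesis identifies [P1] with the average of its images under [S1] and [S2]; a change of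
    variables in each image gives the formula. *)
Lemma ge0_cantor_integral (f : measurableTypeR R -> \bar R) :
  (forall x, 0 <= f x)%E -> measurable_fun setT f ->
  (\int[P1]_x f x = (2^-1)%:E * \int[P1]_x f (S1 x)
                    + (2^-1)%:E * \int[P1]_x f (S2 x))%E.
Proof.
move=> f0 mf.
rewrite (eq_measure_integral (measure_add
    (mscale 2^-1%:nng (distribution P1 (@S1 R : {RV P1 >-> _})))
    (mscale 2^-1%:nng (distribution P1 (@S2 R : {RV P1 >-> _}))))); last first.
  by move=> A mA _; rewrite /= hP1//; exact/esym/measure_addE.
rewrite ge0_integral_measure_add// !ge0_integral_mscale//.
by rewrite !ge0_integral_distribution.
Qed.

(** * Moments and quadratic lower bounds *)

Let mK : measurable K. Proof. exact: measurable_itv. Qed.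

Let P1K : P1 K = 1%E.
Proof.
have := probability_setC P1 (measurableC mK).
by rewrite setCK cantor_support sube0.
Qed.

Let quadratic (p r t : R) : measurableTypeR R -> R :=
  fun x => p * x ^+ 2 + r * x + t.

Let measurable_quadratic p r t : measurable_fun setT (quadratic p r t).
Proof.
by apply: measurable_funD => //; apply: measurable_funD; exact: measurable_funM.
Qed.

(** Boundedness on [K] makes the moments finite a priori, so that self-similarity can later be
    solved for them as a system of real equations. *)
Let integrable_quadratic p r t :
  P1.-integrable K (EFin \o quadratic p r t).
Proof.
apply: measurable_bounded_integrable => //.
- by rewrite /= P1K ltry.
- exact: measurable_funTS.
exists (`|p| + `|r| + `|t|); split; first exact: num_real.
move=> M /ltW hM x; rewrite /K /= in_itv /= => /andP[x0 x2].
apply: le_trans hM; rewrite (le_trans (ler_normD _ _))// lerD2r.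
have x1 : `|x| <= 1 by rewrite ger0_norm//; lra.
by rewrite (le_trans (ler_normD _ _))// !normrM lerD// ler_piMr// mulr_ile1.
Qed.

Let moment k := \int[P1]_(x in K) x ^+ k.

Let Rintegral_quadratic p r t :
  \int[P1]_(x in K) quadratic p r t x = p * moment 2 + r * moment 1 + t.
Proof.
have iq f a b c : f =1 quadratic a b c -> P1.-integrable K (EFin \o f).
  by move=> /funext ->; exact: integrable_quadratic.
rewrite /quadratic RintegralD ?RintegralD ?RintegralZl ?Rintegral_cst//.
- by rewrite /= P1K mulr1.
- by apply: (iq _ 0 1 0) => x; rewrite /quadratic; ring.
- by apply: (iq _ 1 0 0) => x; rewrite /quadratic; ring.
- by apply: (iq _ p 0 0) => x; rewrite /quadratic; ring.
- by apply: (iq _ 0 r 0) => x; rewrite /quadratic; ring.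
- by apply: (iq _ p r 0) => x; rewrite /quadratic; ring.
- by apply: (iq _ 0 0 t) => x; rewrite /quadratic; ring.
Qed.

Let integral_quadratic p r t :
  (\int[P1]_(x in K) (quadratic p r t x)%:E
   = (p * moment 2 + r * moment 1 + t)%:E)%E.
Proof.
rewrite -Rintegral_quadratic fineK//.
by apply: integrable_fin_num => //; exact: integrable_quadratic.
Qed.

Let ge0_integral_K (f : measurableTypeR R -> \bar R) :
  (forall x, 0 <= f x)%E -> measurable_fun setT f ->
  (\int[P1]_x f x = \int[P1]_(x in K) f x)%E.
Proof.
move=> f0 mf; rewrite (@ge0_negligible_integral _ _ _ P1 setT (~` K))//.
- by rewrite setTD setCK.
- exact: measurableC.
- exact: cantor_support.
Qed.

Let ge0_integral_quadratic p r t (f : measurableTypeR R -> R) :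
  f =1 quadratic p r t -> (forall x, 0 <= f x) ->
  (\int[P1]_x (f x)%:E = (p * moment 2 + r * moment 1 + t)%:E)%E.
Proof.
move=> /funext -> q0; rewrite ge0_integral_K//; last exact/measurable_EFinP.

Qed.

(* The self-similarity relation applied to (x + c)^2 for c = 0 and c = 1 is a
   linear system for the two moments. *)
Let moments : moment 1 = 1 / 4 /\ moment 2 = 3 / 32.
Proof.
have I (c : R) : (\int[P1]_x ((x + c) ^+ 2)%:E =
    (1 * moment 2 + (2 * c) * moment 1 + c ^+ 2)%:E)%E.
  apply: ge0_integral_quadratic => x; last exact: sqr_ge0.
  by rewrite /quadratic; ring.
have E (c : R) : moment 2 + 2 * c * moment 1 + c ^+ 2 =
   (2^-1 * (9^-1 * moment 2 + (2 / 3 * c) * moment 1 + c ^+ 2)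
   + 2^-1 * (9^-1 * moment 2 + (2 / 3 * (c + 3^-1)) * moment 1
             + (c + 3^-1) ^+ 2)).
  have := I c; rewrite mul1r ge0_cantor_integral; last 2 first.
  - by move=> x; rewrite lee_fin sqr_ge0.
  - by apply/measurable_EFinP; apply: measurable_funX; exact: measurable_funD.
  rewrite (ge0_integral_quadratic 9^-1 (2 / 3 * c) (c ^+ 2)); last 2 first.
  - by move=> x; rewrite /quadratic /S1; field.
  - by move=> x; exact: sqr_ge0.
  rewrite (ge0_integral_quadratic 9^-1 (2 / 3 * (c + 3^-1)) ((c + 3^-1) ^+ 2));
    last 2 first.
  - by move=> x; rewrite /quadratic /S2; field.
  - by move=> x; exact: sqr_ge0.
  by rewrite -!EFinM -EFinD => -[].
by have := E 0; have := E 1; rewrite !expr2 => e1 e0; split; lra.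
Qed.

(** The variance is 3/32 - (1/4)^2 = 1/32. *)
Lemma cantor_integral_sqr (c : R) :
  (\int[P1]_x ((x - c) ^+ 2)%:E = (1 / 32 + (c - 1 / 4) ^+ 2)%:E)%E.
Proof.
have [m1 m2] := moments.
rewrite (ge0_integral_quadratic 1 (- 2 * c) (c ^+ 2)).
- by rewrite m1 m2; congr EFin; field.
- by move=> x; rewrite /quadratic; ring.
- by move=> x; exact: sqr_ge0.
Qed.

Let ge0_integral_ge_quadratic p r t (f : measurableTypeR R -> R) :
  measurable_fun setT f -> (forall x, 0 <= f x) ->
  (forall x, 0 <= x <= 1 / 2 -> p * x ^+ 2 + r * x + t <= f x) ->
  ((p * (3 / 32) + r / 4 + t)%:E <= \int[P1]_x (f x)%:E)%E.
Proof.
move=> mf f0 qf; rewrite ge0_integral_K//; last exact/measurable_EFinP.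
have -> : (p * (3 / 32) + r / 4 + t)%:E =
    (\int[P1]_(x in K) (quadratic p r t x)%:E)%E.
  by rewrite integral_quadratic; have [-> ->] := moments; congr EFin; field.
have mq : measurable_fun K (EFin \o quadratic p r t).
  by apply/measurable_EFinP; exact: measurable_funTS.
(* The quadratic may be negative somewhere: its negative part is dropped, and monotonicity is
   applied to its positive part, which [f] dominates because [f] is nonnegative. *)
rewrite integralE -[leRHS]sube0 leeB ?integral_ge0//.
apply: ge0_le_integral => //.
- exact: measurable_funepos.
- by apply/measurable_EFinP; exact: measurable_funTS.
move=> x; rewrite /K /= in_itv /= => /andP[x0 x2].
by rewrite funeposE ge_max !lee_fin f0 andbT qf// x0; lra.
Qed.

(** One self-similarity step allows a different quadratic minorant on each half of the Cantor set,
    written in the rescaled variable. The weights 3/64, 1/8 and 1/2 are half the moments 3/32, 1/4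
    and 1. *)
Lemma cantor_integral_ge (f : measurableTypeR R -> R) p1 r1 t1 p2 r2 t2 :
  measurable_fun setT f -> (forall x, 0 <= f x) ->
  (forall x, 0 <= x <= 1 / 2 -> p1 * x ^+ 2 + r1 * x + t1 <= f (x / 3)) ->
  (forall x, 0 <= x <= 1 / 2 ->
     p2 * x ^+ 2 + r2 * x + t2 <= f (x / 3 + 1 / 3)) ->
  (((p1 + p2) * (3 / 64) + (r1 + r2) / 8 + (t1 + t2) / 2)%:E <=
   \int[P1]_x (f x)%:E)%E.
Proof.
move=> mf f0 q1 q2; rewrite ge0_cantor_integral//; last exact/measurable_EFinP.
have I1 : ((p1 * (3 / 32) + r1 / 4 + t1)%:E <= \int[P1]_x (f (S1 x))%:E)%E.
  apply: ge0_integral_ge_quadratic => //; first exact: measurableT_comp.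
  by move=> x /q1; rewrite /S1 [3^-1 * _]mulrC.
have I2 : ((p2 * (3 / 32) + r2 / 4 + t2)%:E <= \int[P1]_x (f (S2 x))%:E)%E.
  apply: ge0_integral_ge_quadratic => //; first exact: measurableT_comp.
  by move=> x /q2; rewrite /S2 [3^-1 * _]mulrC div1r.
apply: (@le_trans _ _ ((2^-1)%:E * (p1 * (3 / 32) + r1 / 4 + t1)%:E
  + (2^-1)%:E * (p2 * (3 / 32) + r2 / 4 + t2)%:E)%E).
  by rewrite -!EFinM -EFinD lee_fin; lra.
by rewrite leeD// lee_pmul2l// lte_fin invr_gt0.
Qed.

End cantor_distribution.

(** * Integration against the mixture and the three-point distribution *)

Lemma ge0_half_mixture_integral {d} {T : measurableType d} {R : realType}
    (P1 P2 : probability T R) (f : T -> \bar R) :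
  (forall x, 0 <= f x)%E -> measurable_fun setT f ->
  (\int[half_mixture P1 P2]_x f x
   = (2^-1)%:E * \int[P1]_x f x + (2^-1)%:E * \int[P2]_x f x)%E.
Proof.
move=> f0 mf; transitivity (\int[measure_add (mscale (2^-1%:nng)%R P1)
  (mscale (2^-1%:nng)%R P2)]_x f x)%E => //.
by rewrite ge0_integral_measure_add// !ge0_integral_mscale.
Qed.

Lemma ge0_three_point_uniform_integral {d} {T : measurableType d}
    {R : realType} (a b c : T) (f : T -> \bar R) :
  (forall x, 0 <= f x)%E -> measurable_fun setT f ->
  (\int[three_point_uniform a b c]_x f x
   = (3^-1)%:E * (f a + f b + f c))%E.
Proof.
move=> f0 mf.
transitivity (\int[mscale (3^-1%:nng)%R
    (msum (fun i => dirac (nth a [:: a; b; c] i)) 3)]_x f x)%E => //.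
rewrite ge0_integral_mscale// ge0_integral_measure_sum//.
by rewrite !big_ord_recl big_ord0 adde0 addeA !integral_dirac// !diracT !mul1e.
Qed.

(** * Distortion of two-point codebooks *)

Definition dmin {R : realType} (a b : R) : measurableTypeR R -> R :=
  fun x => Num.min ((x - a) ^+ 2) ((x - b) ^+ 2).

Section two_means.
Context {R : realType}.

Lemma dmin_ge0 (a b : R) x : 0 <= dmin a b x.
Proof. by rewrite le_min !sqr_ge0. Qed.

Lemma dmin_left (a b : R) x :
  a <= b -> 2 * x <= a + b -> dmin a b x = (x - a) ^+ 2.
Proof. by move=> ab xm; apply/min_idPl; nra. Qed.

Lemma dmin_right (a b : R) x :
  a <= b -> a + b <= 2 * x -> dmin a b x = (x - b) ^+ 2.
Proof. by move=> ab xm; apply/min_idPr; nra. Qed.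

Lemma measurable_dmin (a b : R) : measurable_fun setT (dmin a b).
Proof.
by apply: measurable_minr; apply: measurable_funX; exact: measurable_funB.
Qed.

#[local] Hint Resolve dmin_ge0 measurable_dmin : core.

Lemma distortion_fset2 (Q : borel_probability R) a b :
  distortion Q [fset a; b]%fset = (\int[Q]_x (dmin a b x)%:E)%E.
Proof.
apply: eq_integral => x _.
have [->|ab] := eqVneq a b.
  by rewrite fsetUid big_seq_fset1 /dmin minxx.
by rewrite big_fsetU1 ?inE// big_seq_fset1 /dmin EFin_min.
Qed.

(** Singletons are covered by a = b, so one-point codebooks need no separate treatment. *)
Lemma codebooks2P (alpha : {fset R}) : codebooks 2 alpha ->
  exists a b, a <= b /\ alpha = [fset a; b]%fset.
Proof.
move=> /andP[]; rewrite cardfs_gt0 => /fset0Pn[a aA].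
rewrite (cardfsD1 a) aA add1n ltnS; rewrite leq_eqVlt => /orP[/cardfs1P[b ab]|].
  have -> : alpha = [fset a; b]%fset by rewrite -ab fsetD1K.
  have [le_ab|/ltW le_ba] := leP a b; first by exists a, b.
  by exists b, a; rewrite fsetUC.
rewrite ltnS leqn0 cardfs_eq0 => /eqP A0; exists a, a; split => //.
by rewrite fsetUid -(fsetD1K aA) A0 fsetU0.
Qed.

Variable P1 : borel_probability R.
Hypothesis hP1 : is_cantor_distribution P1.

Let P : borel_probability R := half_mixture P1 (discrete_distribution_D R).

Let distortionE a b : distortion P [fset a; b]%fset =
  ((2^-1)%:E * \int[P1]_x (dmin a b x)%:E
   + (6^-1 * (dmin a b (2 / 3) + dmin a b (5 / 6) + dmin a b 1))%:E)%E.
Proof.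
have d0 x : (0 <= (dmin a b x)%:E)%E by rewrite lee_fin.
have md : measurable_fun setT (EFin \o dmin a b) by exact/measurable_EFinP.
rewrite distortion_fset2 ge0_half_mixture_integral//.
rewrite ge0_three_point_uniform_integral// -!EFinD -!EFinM mulrA.
by congr (_ + (_ * _)%:E)%E; field.
Qed.

(** The cell boundary is at least 1/2, so [a] serves the whole support; the two quadratics are the
    expansions of (x/3 - a)^2 and (x/3 + 1/3 - a)^2. *)
Lemma cantor_dmin_ge a b : a <= b -> 1 <= a + b ->
  ((1 / 32 + (a - 1 / 4) ^+ 2)%:E <= \int[P1]_x (dmin a b x)%:E)%E.
Proof.
move=> ab m2.
apply: (le_trans _ (cantor_integral_ge P1 hP1 _ (9^-1) (- 2 / 3 * a) (a ^+ 2)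
  (9^-1) (2 / 3 * (1 / 3 - a)) ((1 / 3 - a) ^+ 2) _ _ _ _)) => //.
- by rewrite lee_fin; lra.
- by move=> x /andP[_ x2]; rewrite dmin_left//; lra.
- by move=> x /andP[_ x2]; rewrite dmin_left//; lra.
Qed.

Lemma distortion_gt (a b c : R) :
  (c%:E <= \int[P1]_x (dmin a b x)%:E)%E ->
  43 / 1728 < 2^-1 * c
    + 6^-1 * (dmin a b (2 / 3) + dmin a b (5 / 6) + dmin a b 1) ->
  ((43 / 1728)%:E < distortion P [fset a; b]%fset)%E.
Proof.
move=> cI lt; rewrite distortionE; apply: (@lt_le_trans _ _ (_%:E)%E).
  by rewrite lte_fin; exact: lt.
by rewrite EFinD leeD2r// EFinM lee_pmul2l// lte_fin invr_gt0.
Qed.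

Lemma distortion_gt_min a b : a <= b -> (a, b) != (1 / 4, 5 / 6) ->
  ((43 / 1728)%:E < distortion P [fset a; b]%fset)%E.
Proof.
move=> ab abE.
have b3 x : 2 / 3 <= x -> a + b <= 4 / 3 -> dmin a b x = (x - b) ^+ 2.
  by move=> x3 m; apply: dmin_right => //; lra.
have [m1|m1] := leP (a + b) (2 / 3).
  (* The left half is bounded below by 0. The right half has weight 1/2, mean 5/12 and variance
     1/288. *)
  have I : ((1 / 576 + (b - 5 / 12) ^+ 2 / 2)%:E
      <= \int[P1]_x (dmin a b x)%:E)%E.
    apply: (le_trans _ (cantor_integral_ge P1 hP1 _ 0 0 0
      (9^-1) (2 / 3 * (1 / 3 - b)) ((1 / 3 - b) ^+ 2) _ _ _ _)) => //.
    - by rewrite lee_fin; lra.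
    - by move=> x _; rewrite !mul0r !add0r.
    - by move=> x /andP[x0 _]; rewrite dmin_right//; lra.
  (* 25/36 minimizes the resulting bound (b - 5/12)^2 / 4 + (b - 5/6)^2 / 2 up to a constant. *)
  have sq := sqr_ge0 (b - 25 / 36).
  by apply: (distortion_gt _ _ _ I); rewrite !b3; lra.
have [m2|m2] := leP (a + b) 1.
  have I : ((1 / 32 + (a - 1 / 4) ^+ 2 - (b - a) * (1 - a - b) / 4)%:E
      <= \int[P1]_x (dmin a b x)%:E)%E.
    apply: (le_trans _ (cantor_integral_ge P1 hP1 _
      (9^-1) (- 2 / 3 * a) (a ^+ 2)
      (9^-1) (2 / 3 * (1 / 3 - a) - 2 * (b - a) * (1 - a - b))
      ((1 / 3 - a) ^+ 2) _ _ _ _)) => //.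
    - by rewrite lee_fin; lra.
    - by move=> x /andP[_ x2]; rewrite dmin_left//; lra.
    - (* On the right half the loss 2(b - a)(y - (a + b)/2)^+ with respect to
         (y - a)^2 is convex in y, hence below its chord over [1/3, 1/2]. *)
      move=> x /andP[x0 x2]; rewrite /dmin le_min; apply/andP; split.
        have : 0 <= (b - a) * (1 - a - b) * x.
          by rewrite mulr_ge0// mulr_ge0//; lra.
        by lra.
      have : 0 <= (b - a) * ((a + b - 2 / 3) * (1 - 2 * x)).
        by rewrite mulr_ge0 ?subr_ge0// mulr_ge0//; lra.
      by lra.
  (* With s = 1 - a - b, completing the square in b and then in s writes twice the excess of the
     lower bound over 43/1728 as 1/8 of the first square plus 15/32 of the second plus 1/720. *)
  have sq1 := sqr_ge0 (4 * (b - 3 / 4) + (3 / 2 * (1 - a - b) - 1 / 6)).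
  have sq2 := sqr_ge0 (1 - a - b - 1 / 15).
  by apply: (distortion_gt _ _ _ I); rewrite !b3; lra.
have I := cantor_dmin_ge a b ab (ltW m2).
apply: (distortion_gt _ _ _ I).
have [m3|m3] := leP (a + b) (4 / 3).
  (* Here the excess of the lower bound is exactly half this sum, so strictness comes only from
     [abE]. *)
  have sq : 0 < (a - 1 / 4) ^+ 2 + (b - 5 / 6) ^+ 2.
    rewrite lt_def addr_ge0 ?sqr_ge0// andbT paddr_eq0 ?sqr_ge0//.
    rewrite !sqrf_eq0 !subr_eq0.
    by move: abE; rewrite xpair_eqE.
  by rewrite !b3//; lra.
(* The points 5/6 and 1 are bounded below by 0; 17/48 minimizes what remains, (a - 1/4)^2 / 2 + (a -
   2/3)^2 / 6 up to a constant. *)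
have h5 := dmin_ge0 a b (5 / 6); have h1 := dmin_ge0 a b 1.
have sq := sqr_ge0 (a - 17 / 48).
by rewrite (dmin_left a b (2 / 3)) //; lra.
Qed.

Lemma distortion_min :
  distortion P [fset (1 / 4 : R); (5 / 6 : R)]%fset = (43 / 1728)%:E.
Proof.
have I : (\int[P1]_x (dmin (1 / 4) (5 / 6) x)%:E = (1 / 32)%:E)%E.
  have e : 1 / 32 = 1 / 32 + (1 / 4 - 1 / 4) ^+ 2 :> R by field.
  (* The lower bound applies since 1/4 + 5/6 >= 1; the upper bound comes from [dmin] being at most
     (x - 1/4)^2 everywhere. *)
  apply/eqP; rewrite eq_le; apply/andP; split; last first.
    by rewrite [in leLHS]e; apply: cantor_dmin_ge; lra.
  rewrite [in leRHS]e -(cantor_integral_sqr P1 hP1).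
  apply: ge0_le_integral => //.
  - by move=> x _; rewrite lee_fin.
  - exact/measurable_EFinP.
  - by apply/measurable_EFinP; apply: measurable_funX; exact: measurable_funB.
  - by move=> x _; rewrite lee_fin ge_min lexx.
have right_of_gap (x : R) : 2 / 3 <= x ->
    dmin (1 / 4) (5 / 6) x = (x - 5 / 6) ^+ 2.
  by move=> x3; apply: dmin_right; lra.
by rewrite distortionE I -EFinM -EFinD !right_of_gap; [congr EFin; field|lra..].
Qed.

End two_means.

Theorem lemma4p7p1 (R : realType) (P1 : borel_probability R)
    (hP1 : is_cantor_distribution P1) :
  let P2 : borel_probability R := discrete_distribution_D R in
  let P : borel_probability R := half_mixture P1 P2 in
  (forall alpha : {fset R},
     optimal_means 2 P alpha -> alpha = [fset (1 / 4 : R); (5 / 6 : R)]%fset) /\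
  quantization_error 2 P = (43 / 1728)%:E.
Proof.
move=> P2 P.
have min_codebook : codebooks 2 [fset (1 / 4 : R); (5 / 6 : R)]%fset.
  by rewrite /codebooks /= cardfs2; case: eqP.
have error2 : quantization_error 2 P = (43 / 1728)%:E.
  apply/eqP; rewrite eq_le; apply/andP; split.
    apply: ereal_inf_lbound; exists [fset (1 / 4 : R); (5 / 6 : R)]%fset => //.
    exact: distortion_min.
  apply: le_ereal_inf_tmp => _ [alpha /codebooks2P[a [b [ab ->]]] <-].
  have [[-> ->]|abE] := eqVneq (a, b) (1 / 4, 5 / 6).
    by rewrite distortion_min.
  exact/ltW/distortion_gt_min.
split=> // alpha [/codebooks2P[a [b [ab ->]]]]; rewrite error2.
have [[-> ->]//|abE] := eqVneq (a, b) (1 / 4, 5 / 6).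
by have := distortion_gt_min P1 hP1 a b ab abE => /[swap] ->; rewrite ltxx.
Qed.
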